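(* Let $N\ge 2$, let $A\in\mathbb{R}^{n\times n}$, and consider the linear dynamical system $\dot x=Ax(t)$, with flow $\Phi(t,x_0)=e^{At}x_0$. Let $\mathcal{L}(\chi,\lambda)=F(\chi)+\lambda^Tc(\chi)$ be the Lagrangian of the problem $\min_\chi F(\chi)=\frac12\sum_{i=1}^N t_i^2$ subject to $c(\chi)=0$ (objects as defined in the context). Then the Hessian of the Lagrangian with respect to $\chi=[x_0^1,t_1,\ldots,x_0^N,t_N]^T$ is block diagonal, $$\nabla_\chi^2\mathcal{L}(\chi,\lambda)=\begin{bmatrix}\begin{bmatrix}A_1 & v_1 \\ v_1^T & \alpha_1\end{bmatrix} & & \\ & \ddots & \\ & & \begin{bmatrix}A_N & v_N \\ v_N^T & \alpha_N\end{bmatrix}\end{bmatrix}\in\mathbb{R}^{N(n+1)\times N(n+1)},$$ with $A_i\in\mathbb{R}^{n\times n}$, $v_i\in\mathbb{R}^n$, $\alpha_i\in\mathbb{R}$ for $1\le i\le N$, where $$v_i=-\left(Ae^{At_i}\right)^T\lambda_i,\quad 1\le i\le N-1,$$ $$\alpha_i=-\left(A^2e^{At_i}x_0^i\right)^T\lambda_i+1,\quad 1\le i\le N-1,$$ $$A_1=\lambda_I E_I,\qquad A_i=0,\quad 2\le i\le N-1,$$ $$A_N=\lambda_U e^{A^Tt_N}E_U e^{At_N},$$ $$v_N=\lambda_U\left(Ae^{At_N}\right)^T E_U\left(e^{At_N}x_0^N-c_U\right)+\lambda_U e^{A^Tt_N}E_U Ae^{At_N}x_0^N,$$ $$\alpha_N=\lambda_U\left(A^2e^{At_N}x_0^N\right)^T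 E_U\left(e^{At_N}x_0^N-c_U\right)+\lambda_U\left(Ae^{At_N}x_0^N\right)^T E_U Ae^{At_N}x_0^N+1.$$
   Context: $E_I,E_U\in\mathbb{R}^{n\times n}$ are symmetric positive definite matrices, $c_I,c_U\in\mathbb{R}^n$, and $\|v\|_E^2=v^TEv$. The parameter vector is $\chi=[x_0^1,t_1,x_0^2,t_2,\ldots,x_0^N,t_N]^T\in\mathbb{R}^{N(n+1)}$ with $x_0^i\in\mathbb{R}^n$ and $t_i\ge 0$. The objective is $F(\chi)=\frac12\sum_{i=1}^N t_i^2$ and, with $\Phi(t,x_0)=e^{At}x_0$, the constraint vector is $$c(\chi)=\begin{bmatrix}\frac12\left(\|x_0^1-c_I\|_{E_I}^2-1\right) \\ x_0^2-\Phi(t_1,x_0^1) \\ \vdots \\ x_0^N-\Phi(t_{N-1},x_0^{N-1}) \\ \frac12\left(\|\Phi(t_N,x_0^N)-c_U\|_{E_U}^2-1\right)\end{bmatrix}\in\mathbb{R}^{(N-1)n+2}.$$ The Lagrange multiplier vector is $\lambda=[\lambda_I,\lambda_1,\ldots,\lambda_{N-1},\lambda_U]^T\in\mathbb{R}^{(N-1)n+2}$ with $\lambda_I,\lambda_U\in\mathbb{R}$ and $\lambda_i\in\mathbb{R}^n$ for $1\le i\le N-1$. *)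

(* Defs.v *)
From HB Require Import structures.
From mathcomp Require Export all_boot all_order all_algebra.
From mathcomp Require Export all_classical all_reals all_analysis.
Export numFieldNormedType.Exports.

Set Implicit Arguments.
Unset Strict Implicit.
Unset Printing Implicit Defensive.

Import Order.TTheory GRing.Theory Num.Theory.

Local Open Scope classical_set_scope.
Local Open Scope ring_scope.

Definition expmx (R : realType) (n : nat) (A : 'M[R]_n) : 'M[R]_n :=
  lim (series (fun k => k`!%:R^-1 *: A ^+ k) @ \oo).

Definition sym_posdef (R : realType) (n : nat) (E : 'M[R]_n) : Prop :=
  E^T = E /\ forall v : 'cV[R]_n, v != 0 -> 0 < (v^T *m E *m v) 0 0.

Definition sqnorm (R : realType) (n : nat) (E : 'M[R]_n) (v : 'cV[R]_n) : R :=
  (v^T *m E *m v) 0 0.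

Definition gradient (R : realType) (m : nat) (f : 'cV[R]_m -> R)
    (x : 'cV[R]_m) : 'cV[R]_m :=
  \col_i 'D_(delta_mx i 0) f x.

(* 'D_v is a total operator, so the Hessian is only meaningful together with
   twice_differentiable. *)
Definition hessian (R : realType) (m : nat) (f : 'cV[R]_m -> R)
    (x : 'cV[R]_m) : 'M[R]_m :=
  \matrix_(i, j) 'D_(delta_mx j 0) (fun y => gradient f y i 0) x.

Definition twice_differentiable (R : realType) (m : nat) (f : 'cV[R]_m -> R)
    (x : 'cV[R]_m) : Prop :=
  (\forall y \near x, differentiable f y) /\ differentiable (gradient f) x.

Definition flow (R : realType) (n : nat) (A : 'M[R]_n) (t : R)
    (x0 : 'cV[R]_n) : 'cV[R]_n :=
  expmx (t *: A) *m x0.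

(* The parameter vector is N stacked blocks (x_0^i, t_i), so its length is
   \sum_(i < N) (n + 1) = N(n+1).  Block indices are 0-based. *)
Notation param R n N := 'cV[R]_(\sum_(i < N) (n + 1)).

Definition seg_state (R : realType) (n N : nat) (chi : param R n N)
    (i : 'I_N) : 'cV[R]_n :=
  usubmx (@submxcol R N (fun=> n + 1)%N 1 chi i).

Definition seg_time (R : realType) (n N : nat) (chi : param R n N)
    (i : 'I_N) : R :=
  dsubmx (@submxcol R N (fun=> n + 1)%N 1 chi i) 0 0.

(* The N - 1 interior indices j : 'I_N.-1 stand for the consecutive segments
   gap_left j = j and gap_right j = j + 1. *)
Definition gap_left (N : nat) (j : 'I_N.-1) : 'I_N :=
  widen_ord (leq_pred N) j.

Definition gap_right (N : nat) (j : 'I_N.-1) : 'I_N :=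
  Ordinal (etrans (esym (ltn_predRL j N)) (ltn_ord j)).

Definition first_seg (N : nat) (hN : (2 <= N)%N) : 'I_N :=
  Ordinal (ltnW hN).

Lemma pred_ltn (N : nat) : (2 <= N)%N -> (N.-1 < N)%N.
Proof. by case: N. Qed.

Definition last_seg (N : nat) (hN : (2 <= N)%N) : 'I_N :=
  Ordinal (pred_ltn hN).

(* Vectors of length (N-1)n + 2, laid out as a scalar, N - 1 blocks of length
   n, and a scalar. *)
Notation multiplier R n N := 'cV[R]_(1 + ((\sum_(j < N.-1) n) + 1)).

Definition mult_I (R : realType) (n N : nat) (lam : multiplier R n N) : R :=
  usubmx lam 0 0.

Definition mult_gap (R : realType) (n N : nat) (lam : multiplier R n N)
    (j : 'I_N.-1) : 'cV[R]_n :=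
  @submxcol R N.-1 (fun=> n) 1 (usubmx (dsubmx lam)) j.

Definition mult_U (R : realType) (n N : nat) (lam : multiplier R n N) : R :=
  dsubmx (dsubmx lam) 0 0.

Definition objective (R : realType) (n N : nat) (chi : param R n N) : R :=
  2^-1 * \sum_(i < N) seg_time chi i ^+ 2.

Definition constraint (R : realType) (n N : nat) (hN : (2 <= N)%N)
    (A EI EU : 'M[R]_n) (cI cU : 'cV[R]_n) (chi : param R n N)
    : multiplier R n N :=
  let x := seg_state chi in
  let t := seg_time chi in
  let: (i1, iN) := (first_seg hN, last_seg hN) in
  col_mx (2^-1 * (sqnorm EI (x i1 - cI) - 1))%:M
    (col_mx
      (\mxcol_(j < N.-1)
         (x (gap_right j) - flow A (t (gap_left j)) (x (gap_left j))))
      (2^-1 * (sqnorm EU (flow A (t iN) (x iN) - cU) - 1))%:M).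

Definition lagrangian (R : realType) (n N : nat) (hN : (2 <= N)%N)
    (A EI EU : 'M[R]_n) (cI cU : 'cV[R]_n) (chi : param R n N)
    (lam : multiplier R n N) : R :=
  objective chi + (lam^T *m constraint hN A EI EU cI cU chi) 0 0.

(* Main.v *)
(** Apart from terms affine in the states x_i, the Lagrangian is a sum of
    functions, one for each segment, of (x_i, t_i) alone:
      t^2/2 + x.Px/2 + z.Qz/2 + d.z   with   z = e^{At} x,
    where P = lambda_I E_I on the first segment and 0 elsewhere, while
    (Q, d) = (lambda_U E_U, - lambda_U E_U c_U) on the last segment and
    (0, - lambda_i) elsewhere.  Hence the Hessian is block diagonal, and every
    block comes from the same computation, in which only the derivative
    A e^{At} of e^{At} is not algebraic.  That derivative is obtained entrywise,
    each entry of B e^{At} being an everywhere convergent power series in t whose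
    formal derivative is the series of B A e^{At}. *)
From HB Require Import structures.
From mathcomp Require Import ring.
Require Import Defs.

Set Implicit Arguments.
Unset Strict Implicit.
Unset Printing Implicit Defensive.

Import Order.TTheory GRing.Theory Num.Theory.

Local Open Scope classical_set_scope.
Local Open Scope ring_scope.

(** * Continuity, convergence and differentials of matrix-valued maps *)

Lemma mx_linear_continuous (R : realType) (m n : nat) (W : normedModType R)
    (f : {linear 'M[R]_(m, n) -> W}) : continuous f.
Proof.
(* A linear map on matrices is a finite sum of coordinate functions times fixed vectors. *)
have -> : (f : _ -> _) = (fun M => \sum_i \sum_j M i j *: f (delta_mx i j)).
  apply/funext => M; rewrite {1}(matrix_sum_delta M) linear_sum.
  apply: eq_bigr => i _; rewrite linear_sum.
  by apply: eq_bigr => j _; rewrite linearZ.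
apply: continuous_big => [|i _]; first exact: add_continuous.
apply: continuous_big => [|j _]; first exact: add_continuous.
by move=> M; apply: (@cvgZr_tmp _ _ _ (nbhs M)); exact: (@coord_continuous R).
Qed.

Lemma is_diff_mx_linear (R : realType) (m n : nat) (W : normedModType R)
    (f : {linear 'M[R]_(m, n) -> W}) (M : 'M[R]_(m, n)) : is_diff M f f.
Proof.
apply: DiffDef; first exact/linear_differentiable/mx_linear_continuous.
exact/diff_lin/mx_linear_continuous.
Qed.

Lemma cvg_mx (R : realType) (T : Type) (F : set_system T) (FF : Filter F)
    (m n : nat) (S : T -> 'M[R]_(m, n)) (M : 'M[R]_(m, n)) :
  (forall i j, (fun k => S k i j) @ F --> M i j) -> S @ F --> M.
Proof.
move=> SM; rewrite (matrix_sum_delta M).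
have -> : S = (fun k => \sum_i \sum_j S k i j *: delta_mx i j).
  by apply/funext => k; rewrite {1}(matrix_sum_delta (S k)).
apply: cvg_big => [|i _]; first exact: add_continuous.
apply: cvg_big => [|j _]; first exact: add_continuous.
exact: cvgZr_tmp.
Qed.

(** A matrix is the finite sum of its entries times the fixed matrices [delta_mx i j], so scalar
    differentials assemble. Products and the exponential are differentiated in this way. *)
Lemma is_diff_mx (R : realType) (V : normedModType R) (m n : nat)
    (M dM : V -> 'M[R]_(m, n)) (x : V) :
  (forall i j, is_diff x (fun y => M y i j) (fun h => dM h i j)) ->
  is_diff x M dM.
Proof.
move=> MdM.
have mxE2 (N : V -> 'M[R]_(m, n)) :
    N = \sum_i \sum_j (( *:%R ^~ (delta_mx i j)) \o (fun y => N y i j)).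
  apply/funext => y; rewrite {1}(matrix_sum_delta (N y)) fct_sumE.
  by apply: eq_bigr => i _; rewrite fct_sumE.
rewrite (mxE2 M) (mxE2 dM).
elim/big_ind2 : _ => [|? ? ? ? ? ?|i _].
- exact: is_diff_cst.
- exact: is_diffD.
elim/big_ind2 : _ => [|? ? ? ? ? ?|j _].
- exact: is_diff_cst.
- exact: is_diffD.
- exact: is_diff_comp.
Qed.

Lemma is_diff_sum (R : realType) (V W : normedModType R) (I : Type)
    (r : seq I) (f df : I -> V -> W) (x : V) :
  (forall i, is_diff x (f i) (df i)) ->
  is_diff x (fun y => \sum_(i <- r) f i y) (fun h => \sum_(i <- r) df i h).
Proof.
move=> fdf.
have -> (g : I -> V -> W) : (fun y => \sum_(i <- r) g i y) = \sum_(i <- r) g i.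
  by apply/funext => y; rewrite fct_sumE.
have -> (g : I -> V -> W) : (fun y => \sum_(i <- r) g i y) = \sum_(i <- r) g i.
  by apply/funext => y; rewrite fct_sumE.
elim/big_ind2 : _ => [|? ? ? ? ? ?|//].
- exact: is_diff_cst.
- exact: is_diffD.
Qed.

Lemma is_diff_coord (R : realType) (V : normedModType R) (m n : nat)
    (M dM : V -> 'M[R]_(m, n)) (x : V) i j :
  is_diff x M dM -> is_diff x (fun y => M y i j) (fun h => dM h i j).
Proof.
move=> MdM.
pose f (N : 'M[R]_(m, n)) := N i j.
have lf : linear f by move=> a u v; rewrite /f !mxE.
pose fM := GRing.isLinear.Build _ _ _ _ _ lf.
pose fL : {linear _ -> _} := HB.pack f fM.
have := is_diff_mx_linear fL (M x).
exact: is_diff_comp.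
Qed.

Lemma is_diff_mulmx (R : realType) (V : normedModType R) (m n p : nat)
    (M dM : V -> 'M[R]_(m, n)) (N dN : V -> 'M[R]_(n, p)) (x : V) :
  is_diff x M dM -> is_diff x N dN ->
  is_diff x (fun y => M y *m N y) (fun h => dM h *m N x + M x *m dN h).
Proof.
move=> MdM NdN; apply: is_diff_mx => i j.
have -> : (fun y => (M y *m N y) i j) =
    (fun y => \sum_k ((fun z => M z i k) * (fun z => N z k j)) y).
  by apply/funext => y; rewrite mxE.
apply: is_diff_eq.
  apply: is_diff_sum => k.
  by apply: is_diffM; apply: is_diff_coord.
apply/funext => h; rewrite !mxE -big_split; apply: eq_bigr => k _ /=.
by rewrite addrC; congr (_ + _); rewrite mulrC.
Qed.

(** * The matrix exponential: entrywise power series, derivative and transpose *)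

Lemma expr_mx_entry_le (R : realType) (m n : nat) (B : 'M[R]_(m, n))
    (A : 'M[R]_n) (k : nat) i j :
  `|(B *m A ^+ k) i j| <=
    (\sum_a \sum_b `|B a b|) * (\sum_a \sum_b `|A a b|) ^+ k.
Proof.
(* The sum of the absolute values of all entries is a submultiplicative norm dominating each
   entry. *)
have row_le p q (C : 'M[R]_(p, q)) a : \sum_b `|C a b| <= \sum_a \sum_b `|C a b|.
  rewrite (bigD1 a) //= lerDl sumr_ge0 // => c _; exact: sumr_ge0.
have entry_le p q (C : 'M[R]_(p, q)) a b : `|C a b| <= \sum_b `|C a b|.
  by rewrite (bigD1 b) //= lerDl sumr_ge0.
elim: k m B i j => [|k IHk] m B i j.
  rewrite !expr0 mulr1 -[1]/(1%:M) mulmx1.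
  exact: le_trans (entry_le _ _ _ _ _) (row_le _ _ _ _).
(* [B] absorbs one factor [A]: the induction hypothesis is used at [B *m A], hence the
   generalisation over [B]. *)
rewrite exprS -mulmxE mulmxA (le_trans (IHk _ _ _ _)) // exprS mulrA.
rewrite ler_wpM2r ?exprn_ge0 ?sumr_ge0 //; first by move=> *; exact: sumr_ge0.
rewrite mulr_suml ler_sum // => a _.
apply: (@le_trans _ _ (\sum_c \sum_b `|B a b| * `|A b c|)).
  apply: ler_sum => c _; rewrite mxE (le_trans (ler_norm_sum _ _ _)) //.
  by apply: ler_sum => b _; rewrite normrM.
rewrite exchange_big mulr_suml ler_sum //= => b _.
by rewrite -mulr_sumr ler_wpM2l // row_le.
Qed.

(** Taylor coefficients in t of the (i, j) entry of B e^{tA}. *)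
Definition expmx_coef (R : realType) (m n : nat) (B : 'M[R]_(m, n))
    (A : 'M[R]_n) i j (k : nat) : R :=
  k`!%:R^-1 * (B *m A ^+ k) i j.

(** Comparison with the series of b exp(a|t|), where a and b are the entry sums in
    [expr_mx_entry_le]. *)
Lemma is_cvg_expmx_coef (R : realType) (m n : nat) (B : 'M[R]_(m, n))
    (A : 'M[R]_n) i j (t : R) :
  cvgn (pseries (expmx_coef B A i j) t).
Proof.
set b := \sum_a \sum_b `|B a b|; set a := \sum_a \sum_b `|A a b|.
have b0 : 0 <= b by rewrite sumr_ge0 // => *; exact: sumr_ge0.
have a0 : 0 <= a by rewrite sumr_ge0 // => *; exact: sumr_ge0.
apply: normed_cvg; apply: (@series_le_cvg _ _ (b *: exp_coeff (a * `|t|))).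
- by move=> k; rewrite normr_ge0.
- by move=> k; rewrite mulr_ge0 // exp_coeff_ge0 // mulr_ge0.
- move=> k; rewrite exp_coeffE /expmx_coef /= normrM normrM normrX.
  rewrite ger0_norm ?invr_ge0 // -[leRHS]/(b * (k`!%:R^-1 * (a * `|t|) ^+ k)).
  rewrite exprMn mulrCA -[leLHS]mulrA.
  rewrite ler_wpM2l ?invr_ge0 // mulrA ler_wpM2r ?exprn_ge0 //.
  exact: expr_mx_entry_le.
- by apply: is_cvg_seriesZ; exact: is_cvg_series_exp_coeff.
Qed.

(* The left factor B makes the family closed under formal differentiation. *)
Lemma pseries_diffs_expmx_coef (R : realType) (m n : nat) (B : 'M[R]_(m, n))
    (A : 'M[R]_n) i j :
  pseries_diffs (expmx_coef B A i j) = expmx_coef (B *m A) A i j.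
Proof.
apply/funext => k; rewrite /pseries_diffs /expmx_coef factS natrM invfM mulrA.
by rewrite mulVKf ?pnatr_eq0 // exprS -mulmxE mulmxA.
Qed.

Lemma scaler_expr_mx (R : realType) (n : nat) (A : 'M[R]_n) (t : R) (k : nat) :
  (t *: A) ^+ k = t ^+ k *: A ^+ k.
Proof.
elim: k => [|k IHk]; first by rewrite !expr0 scale1r.
by rewrite !exprS IHk -!mulmxE -scalemxAl -scalemxAr scalerA.
Qed.

(** [expmx] is a bare [lim], so convergence must be known before anything passes through it.
    Entrywise the series is a power series at t = 1. *)
Lemma cvg_expmx (R : realType) (n : nat) (A : 'M[R]_n) :
  series (fun k => k`!%:R^-1 *: A ^+ k) @ \oo --> expmx A.
Proof.
apply/cvg_ex; exists (\matrix_(i, j) limn (pseries (expmx_coef 1%:M A i j) 1)).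
apply: cvg_mx => i j; rewrite mxE.
rewrite (_ : (fun k => _) = pseries (expmx_coef 1%:M A i j) 1).
  exact: is_cvg_expmx_coef.
apply/funext => k; rewrite /series /= summxE; apply: eq_bigr => l _.
by rewrite /= /expmx_coef mul1mx mxE expr1n mulr1.
Qed.

(** Left multiplication by [B] and taking an entry are linear and continuous, so both pass through
    the limit of the partial sums. *)
Lemma mulmx_expmxE (R : realType) (m n : nat) (B : 'M[R]_(m, n))
    (A : 'M[R]_n) (t : R) i j :
  (B *m expmx (t *: A)) i j = limn (pseries (expmx_coef B A i j) t).
Proof.
apply/esym/cvg_lim => //.
have Bc : series (fun k => k`!%:R^-1 *: (t *: A) ^+ k) k @[k --> \oo]
   --> expmx (t *: A) by exact: cvg_expmx.
have BE := cvg_comp _ _ Bc (@mx_linear_continuous _ _ _ _ (mulmx B) _).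
have := cvg_comp _ _ BE (@coord_continuous R _ _ i j _).
rewrite (_ : _ \o _ = pseries (expmx_coef B A i j) t) //.
apply/funext => k; rewrite /series /= mulmx_sumr summxE.
apply: eq_bigr => l _; rewrite /expmx_coef scaler_expr_mx -!scalemxAr.
by rewrite scalerA mxE mulrAC.
Qed.

Lemma is_diff_expmx (R : realType) (n : nat) (A : 'M[R]_n) (t : R) :
  is_diff t (fun s => expmx (s *: A)) (fun h => h *: (A *m expmx (t *: A))).
Proof.
apply: is_diff_mx => i j.
have dE : is_derive t (1 : R) (fun s => expmx (s *: A) i j)
    ((A *m expmx (t *: A)) i j).
  have -> : (fun s => expmx (s *: A) i j) =
      (fun s => limn (pseries (expmx_coef 1%:M A i j) s)).
    by apply/funext => s; rewrite -mulmx_expmxE mul1mx.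
  rewrite mulmx_expmxE -{2}(mul1mx A) -pseries_diffs_expmx_coef.
  (* Termwise differentiation asks for a point beyond |t| at which the series and its first two
     formal derivatives converge; |t| + 1 serves. *)
  apply: (@pseries_snd_diffs _ _ (`|t| + 1)); rewrite ?pseries_diffs_expmx_coef;
    try exact: is_cvg_expmx_coef.
  by rewrite [ltRHS]ger0_norm ?addr_ge0 // ltrDl.
have df : differentiable (fun s : R => expmx (s *: A) i j) t.
  exact/derivable1_diffP.
apply: DiffDef => //; rewrite diff1E // derive1E derive_val.
by apply/funext => h; rewrite [RHS]mxE.
Qed.

Lemma tr_expmx (R : realType) (n : nat) (A : 'M[R]_n) :
  (expmx A)^T = expmx A^T.
Proof.
apply/esym/cvg_lim => //.
have := cvg_comp _ _ (@cvg_expmx _ _ A) (@mx_linear_continuous _ _ _ _ trmx _).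
rewrite (_ : _ \o _ = series (fun k => k`!%:R^-1 *: A^T ^+ k)) //.
apply/funext => k; rewrite /series /= linear_sum; apply: eq_bigr => l _.
rewrite linearZ; congr (_ *: _).
elim: l => [|l IHl] /=; first by rewrite !expr0; exact: trmx1.
rewrite exprS [RHS]exprSr -IHl; exact: trmx_mul.
Qed.

(** * Differentials of compositions and inner products, and Hessians read off from them *)

Lemma is_diff_comp_mx_linear (R : realType) (V W : normedModType R) (m n : nat)
    (f : {linear 'M[R]_(m, n) -> W}) (M dM : V -> 'M[R]_(m, n)) (x : V) :
  is_diff x M dM -> is_diff x (fun y => f (M y)) (fun h => f (dM h)).
Proof.
by move=> MdM; have fM := is_diff_mx_linear f (M x); exact: is_diff_comp.
Qed.

Lemma is_diff_scalemx (R : realType) (V : normedModType R) (m n : nat)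
    (c dc : V -> R) (M dM : V -> 'M[R]_(m, n)) (x : V) :
  is_diff x c dc -> is_diff x M dM ->
  is_diff x (fun y => c y *: M y) (fun h => dc h *: M x + c x *: dM h).
Proof.
move=> cdc MdM; apply: is_diff_mx => i j.
have -> : (fun y => (c y *: M y) i j) = c * (fun y => M y i j).
  by apply/funext => y; rewrite mxE.
apply: is_diff_eq; first by apply: is_diffM; apply: is_diff_coord.
by apply/funext => h; rewrite !mxE addrC; congr (_ + _); exact: mulrC.
Qed.

Definition dotv (R : realType) (n : nat) (u v : 'cV[R]_n) : R :=
  (u^T *m v) 0 0.

Section Dotv.
Variables (R : realType) (n : nat).
Implicit Types (u v w : 'cV[R]_n) (a : R).

Lemma dotvC u v : dotv u v = dotv v u.
Proof. by rewrite /dotv -[v^T *m u]trmxK trmx_mul trmxK [RHS]mxE. Qed.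

Lemma dotvDl u v w : dotv (u + v) w = dotv u w + dotv v w.
Proof. by rewrite /dotv linearD mulmxDl mxE. Qed.

Lemma dotvDr u v w : dotv w (u + v) = dotv w u + dotv w v.
Proof. by rewrite /dotv mulmxDr mxE. Qed.

Lemma dotvZl a u w : dotv (a *: u) w = a * dotv u w.
Proof. by rewrite /dotv linearZ -scalemxAl mxE. Qed.

Lemma dotvZr a u w : dotv w (a *: u) = a * dotv w u.
Proof. by rewrite dotvC dotvZl dotvC. Qed.

Lemma dotvNl u w : dotv (- u) w = - dotv u w.
Proof. by rewrite -scaleN1r dotvZl mulN1r. Qed.

Lemma dotvNr u w : dotv w (- u) = - dotv w u.
Proof. by rewrite dotvC dotvNl dotvC. Qed.

Lemma dotv0l w : dotv 0 w = 0.
Proof. by rewrite -(scale0r 0) dotvZl mul0r. Qed.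

Lemma dotv0r w : dotv w 0 = 0.
Proof. by rewrite dotvC dotv0l. Qed.

Lemma dotv_adj m (M : 'M[R]_(m, n)) (u : 'cV[R]_m) w :
  dotv u (M *m w) = dotv (M^T *m u) w.
Proof. by rewrite /dotv trmx_mul trmxK mulmxA. Qed.

Lemma sqnormE (E : 'M[R]_n) w : sqnorm E w = dotv w (E *m w).
Proof. by rewrite /sqnorm /dotv mulmxA. Qed.

End Dotv.

Lemma is_diff_dotv (R : realType) (V : normedModType R) (n : nat)
    (M dM N dN : V -> 'cV[R]_n) (x : V) :
  is_diff x M dM -> is_diff x N dN ->
  is_diff x (fun y => dotv (M y) (N y))
            (fun h => dotv (dM h) (N x) + dotv (M x) (dN h)).
Proof.
move=> MdM NdN.
have MT := @is_diff_comp_mx_linear _ _ _ _ _ trmx _ _ _ MdM.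
apply: is_diff_eq; first by apply: is_diff_coord; apply: is_diff_mulmx.
by apply/funext => h; rewrite mxE.
Qed.

(** Fixing the direction u leaves a scalar function to differentiate again. Taking u = e_i and w =
    e_j recovers the gradient entries and [H i j]. *)
Lemma hessian_of_diff (R : realType) (m : nat) (f : 'cV[R]_m -> R)
    (df : 'cV[R]_m -> 'cV[R]_m -> R) (x : 'cV[R]_m) (H : 'M[R]_m) :
  (forall y, is_diff y f (df y)) ->
  (forall u, is_diff x (fun y => df y u) (fun w => dotv u (H *m w))) ->
  twice_differentiable f x /\ hessian f x = H.
Proof.
move=> fdf dfH.
have gradE : gradient f = (fun y => \col_i df y (delta_mx i 0)).
  apply/funext => y; apply/colP => i; rewrite !mxE deriveE; last exact: ex_diff.
  by rewrite diff_val.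
split; first split.
- by apply: (@nearW _ (nbhs x)) => y; exact: ex_diff.
- have := @is_diff_mx _ _ _ _ (gradient f)
    (fun w => \matrix_(i, j) dotv (delta_mx i 0) (H *m w)) x.
  case=> // i j; rewrite gradE.
  rewrite (_ : (fun y => _) = (fun y => df y (delta_mx i 0))).
    by apply: is_diff_eq; apply/funext => w; rewrite mxE.
  by apply/funext => y; rewrite mxE.
apply/matrixP => i j; rewrite mxE gradE.
rewrite (_ : (fun y => _) = (fun y => df y (delta_mx i 0))); last first.
  by apply/funext => y; rewrite mxE.
have dij := dfH (delta_mx i 0).
rewrite deriveE; last exact: ex_diff.
by rewrite diff_val -colE /dotv trmx_delta -rowE !mxE.
Qed.

(** * Block coordinates of the parameter vector and block bilinear forms *)

Lemma is_diff_seg_state (R : realType) (n N : nat) (i : 'I_N)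
    (y : param R n N) :
  is_diff y (fun z : param R n N => seg_state z i)
            (fun h : param R n N => seg_state h i).
Proof.
apply: is_diff_mx => a b.
have -> : (fun z : param R n N => seg_state z i a b) =
    (fun z : param R n N => z (@tagnat.Rank N (fun=> n + 1)%N i (lshift 1 a)) b).
  by apply/funext => z; rewrite !mxE.
exact: is_diff_coord.
Qed.

Lemma is_diff_seg_time (R : realType) (n N : nat) (i : 'I_N)
    (y : param R n N) :
  is_diff y (fun z : param R n N => seg_time z i)
            (fun h : param R n N => seg_time h i).
Proof.
have -> : (fun z : param R n N => seg_time z i) =
    (fun z : param R n N => z (@tagnat.Rank N (fun=> n + 1)%N i (rshift n 0)) 0).
  by apply/funext => z; rewrite /seg_time !mxE.
exact: is_diff_coord.
Qed.

Lemma dotv_col_mx (R : realType) (m n : nat) (a c : 'cV[R]_m) (b d : 'cV[R]_n) :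
  dotv (col_mx a b) (col_mx c d) = dotv a c + dotv b d.
Proof. by rewrite /dotv tr_col_mx mul_row_col mxE. Qed.

Lemma dotv_scalar (R : realType) (a b : R) : dotv a%:M b%:M = a * b.
Proof. by rewrite /dotv tr_scalar_mx -scalar_mxM mxE eqxx. Qed.

Lemma dotv_block_mx (R : realType) (n : nat) (H : 'M[R]_n) (v x y : 'cV[R]_n)
    (a s t : R) :
  dotv (col_mx x s%:M) (block_mx H v v^T a%:M *m col_mx y t%:M) =
  dotv x (H *m y) + t * dotv x v + s * (dotv v y + a * t).
Proof.
rewrite mul_block_col dotv_col_mx mul_mx_scalar -scalar_mxM.
by rewrite [v^T *m y]mx11_scalar -raddfD dotv_scalar dotvDr dotvZr.
Qed.

(** * First and second differentials of the cost of one segment *)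

Section SegmentCost.
Variables (R : realType) (V : normedModType R) (n : nat).
Variables (A P Q : 'M[R]_n) (d : 'cV[R]_n) (X : V -> 'cV[R]_n) (T : V -> R).
(** [X] and [T] stand for linear projections, each its own differential at every point. This keeps
    the computation free of the block layout. *)
Hypothesis dX : forall y, is_diff y X X.
Hypothesis dT : forall y, is_diff y T T.
Hypotheses (symP : P^T = P) (symQ : Q^T = Q).

Let E y := expmx (T y *: A).
Let Z y := E y *m X y.
Let dZ y h := T h *: (A *m Z y) + E y *m X h.

Definition segment_cost (y : V) : R :=
  2^-1 * T y ^+ 2 + 2^-1 * dotv (X y) (P *m X y)
  + 2^-1 * dotv (Z y) (Q *m Z y) + dotv d (Z y).

Definition segment_cost_diff (y h : V) : R :=
  T h * T y + dotv (P *m X y) (X h) + dotv (Q *m Z y + d) (dZ y h).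

(** In the three blocks, terms with g = Qz + d come from second derivatives of z = e^{At}x, and
    terms with Q between two factors from products of first derivatives. As z is linear in x, the xx
    block has no g term; the 1 in the tt block comes from t^2/2. *)
Definition segment_hess_xx (y : V) : 'M[R]_n := P + (E y)^T *m Q *m E y.

Definition segment_hess_xt (y : V) : 'cV[R]_n :=
  (A *m E y)^T *m (Q *m Z y + d) + (E y)^T *m Q *m A *m Z y.

Definition segment_hess_tt (y : V) : R :=
  dotv (A ^+ 2 *m Z y) (Q *m Z y + d) + dotv (A *m Z y) (Q *m A *m Z y) + 1.

Definition segment_hess (y : V) : 'M[R]_(n + 1) :=
  block_mx (segment_hess_xx y) (segment_hess_xt y)
           (segment_hess_xt y)^T (segment_hess_tt y)%:M.

Definition segment_var (h : V) : 'cV[R]_(n + 1) := col_mx (X h) (T h)%:M.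

Let is_diff_E y : is_diff y E (fun h => T h *: (A *m E y)).
Proof. exact: (is_diff_comp (dT y) (is_diff_expmx A (T y))). Qed.

Let is_diff_Z y : is_diff y Z (dZ y).
Proof.
have := is_diff_E y => dE; have dXy := dX y.
apply: is_diff_eq; first exact: is_diff_mulmx.
by apply/funext => h; rewrite /dZ /Z -scalemxAl mulmxA.
Qed.

Let is_diff_mulmxl m p (M : 'M[R]_(m, p)) (f df : V -> 'cV[R]_p) y :
  is_diff y f df -> is_diff y (fun z => M *m f z) (fun h => M *m df h).
Proof. exact: (@is_diff_comp_mx_linear _ _ _ _ _ (mulmx M)). Qed.

Lemma is_diff_segment_cost y :
  is_diff y segment_cost (segment_cost_diff y).
Proof.
have dTy := dT y; have dXy := dX y; have dZy := is_diff_Z y.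
have dPX := is_diff_mulmxl P dXy; have dQZ := is_diff_mulmxl Q dZy.
have d1 := is_diffZ 2^-1 (is_diffM dTy dTy).
have d2 := is_diffZ 2^-1 (is_diff_dotv dXy dPX).
have d3 := is_diffZ 2^-1 (is_diff_dotv dZy dQZ).
have d4 := is_diff_dotv (is_diff_cst d y) dZy.
have d5 := is_diffD (is_diffD (is_diffD d1 d2) d3) d4.
apply: (is_diff_eq d5); apply/funext => h.
rewrite /segment_cost_diff -[LHS]/(2^-1 * (T y * T h + T y * T h)
  + 2^-1 * (dotv (X h) (P *m X y) + dotv (X y) (P *m X h))
  + 2^-1 * (dotv (dZ y h) (Q *m Z y) + dotv (Z y) (Q *m dZ y h))
  + (dotv 0 (Z y) + dotv d (dZ y h))).
(* Symmetry of P and Q makes the two terms of each product rule equal, which cancels the factors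
   1/2. *)
rewrite dotv0l !(dotv_adj _ (X y)) !(dotv_adj _ (Z y)) symP symQ.
rewrite (dotvDl _ d).
rewrite (dotvC (X h)) (dotvC (dZ y h)).
by field.
Qed.

Lemma is_diff_segment_cost_diff y h :
  is_diff y (fun z => segment_cost_diff z h)
    (fun k => dotv (segment_var h) (segment_hess y *m segment_var k)).
Proof.
have dTy := dT y; have dXy := dX y; have dZy := is_diff_Z y.
have dPX := is_diff_mulmxl P dXy; have dQZ := is_diff_mulmxl Q dZy.
have dAZ := is_diff_mulmxl A dZy.
have dEX := is_diff_mulmx (is_diff_E y) (is_diff_cst (X h) y).
have ddZ := is_diffD (is_diffZ (T h) dAZ) dEX.
have d1 := is_diffZ (T h) dTy.
have d2 := is_diff_dotv dPX (is_diff_cst (X h) y).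
have d3 := is_diff_dotv (is_diffD dQZ (is_diff_cst d y)) ddZ.
have d5 := is_diffD (is_diffD d1 d2) d3.
apply: (is_diff_eq d5); apply/funext => k.
rewrite -[LHS]/(T h * T k + (dotv (P *m X k) (X h) + dotv (P *m X y) 0)
  + (dotv (Q *m dZ y k + 0) (T h *: (A *m Z y) + E y *m X h)
   + dotv (Q *m Z y + d)
       (T h *: (A *m dZ y k) + ((T k *: (A *m E y)) *m X h + E y *m 0)))).
rewrite /segment_hess /segment_var dotv_block_mx.
rewrite /segment_hess_xx /segment_hess_xt /segment_hess_tt.
rewrite -/(E y) -/(Z y).
(* Generalising g keeps the distributivity rewrites below from splitting it. *)
move: (Q *m Z y + d) => g.
rewrite /dZ !mulmx0 !addr0 dotv0r addr0 -scalemxAl.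
rewrite !(mulmxDr, mulmxDl) -!scalemxAr.
rewrite !(dotvDl, dotvDr, dotvZl, dotvZr) -!mulmxA.
(* The two sides now differ by moving Q across inner products and swapping arguments. A common
   normal form gives [ring] the same atoms on both sides. *)
have adjQ u w : dotv (Q *m u) w = dotv u (Q *m w) by rewrite dotv_adj symQ.
have dotvQ u w : dotv u (Q *m w) = dotv w (Q *m u) by rewrite dotvC adjQ.
rewrite !adjQ (dotvC (P *m _)) !(dotvC _ (X k)).
rewrite !(dotv_adj (E y)^T) !(dotv_adj (A *m E y)^T) !trmxK !(dotvC g) -!mulmxA.
rewrite (dotvQ (E y *m X h)) (dotvQ (E y *m X k) (A *m Z y)).
rewrite (dotvQ (E y *m X h)).
by ring.
Qed.
End SegmentCost.

(** * Decomposition of the Lagrangian into segment costs *)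

Lemma sum_gap_last (V : nmodType) (N : nat) (hN : (2 <= N)%N) (F : 'I_N -> V) :
  \sum_(i < N) F i = \sum_(j < N.-1) F (gap_left j) + F (last_seg hN).
Proof.
case: N hN F => // N hN F; rewrite big_ord_recr /=; congr (_ + F _).
  by apply: eq_bigr => j _; congr F; exact: val_inj.
exact: val_inj.
Qed.

Lemma mult_constraintE (R : realType) (n N : nat) (lam : multiplier R n N)
    (a b : R) (f : 'I_N.-1 -> 'cV[R]_n) :
  (lam^T *m col_mx a%:M (col_mx (\mxcol_j f j) b%:M)) 0 0 =
  mult_I lam * a + (\sum_j dotv (mult_gap lam j) (f j) + mult_U lam * b).
Proof.
rewrite -/(dotv _ _) -{1}(vsubmxK lam) -{1}(vsubmxK (dsubmx lam)).
rewrite !dotv_col_mx [usubmx lam]mx11_scalar [dsubmx (dsubmx lam)]mx11_scalar.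
rewrite !dotv_scalar; congr (_ + (_ + _)).
rewrite -{1}(submxcolK (usubmx (dsubmx lam))) /dotv tr_mxcol mul_mxrow_mxcol.
by rewrite summxE.
Qed.

Lemma segment_varE (R : realType) (n N : nat) (i : 'I_N) (h : param R n N) :
  segment_var (fun z : param R n N => seg_state z i)
    (fun z : param R n N => seg_time z i) h =
  @submxcol R N (fun=> n + 1)%N 1 h i.
Proof. by rewrite /segment_var /seg_time -mx11_scalar vsubmxK. Qed.

(** This is where block diagonality arises: a sum of bilinear forms, one for each segment, has a
    block diagonal matrix. *)
Lemma dotv_mxdiag (R : realType) (n N : nat) (B : 'I_N -> 'M[R]_(n + 1))
    (u w : param R n N) :
  dotv u ((\mxdiag_(i < N) B i) *m w) =
  \sum_i dotv (@submxcol R N (fun=> n + 1)%N 1 u i)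
              (B i *m @submxcol R N (fun=> n + 1)%N 1 w i).
Proof.
rewrite -{1}(@submxcolK R N (fun=> n + 1)%N 1 u).
rewrite -{1}(@submxcolK R N (fun=> n + 1)%N 1 w) mul_mxdiag_mxcol.
by rewrite /dotv tr_mxcol mul_mxrow_mxcol summxE.
Qed.

Section LagrangianSplit.
Variables (R : realType) (n N : nat) (hN : (2 <= N)%N).
Variables (A EI EU : 'M[R]_n) (cI cU : 'cV[R]_n) (lam : multiplier R n N).
Hypotheses (symEI : EI^T = EI) (symEU : EU^T = EU).

Let x (i : 'I_N) (y : param R n N) : 'cV[R]_n := seg_state y i.
Let t (i : 'I_N) (y : param R n N) : R := seg_time y i.

Definition init_weight (i : 'I_N) : 'M[R]_n :=
  if i == first_seg hN then mult_I lam *: EI else 0.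

Definition final_weight (i : 'I_N) : 'M[R]_n :=
  if i == last_seg hN then mult_U lam *: EU else 0.

(* [insub i] is [None] exactly when i is the last segment, see gap_left. *)
Definition flow_covector (i : 'I_N) : 'cV[R]_n :=
  oapp (fun j : 'I_N.-1 => - mult_gap lam j) (- (mult_U lam *: (EU *m cU)))
    (insub (i : nat)).

(** The state after a gap meets the preceding segment only through a linear term, so neighbouring
    segments do not interact in the Hessian. Constants are left to [lagrangian_split], which makes
    this part its own differential. *)
Definition affine_part (y : param R n N) : R :=
  \sum_(j < N.-1) dotv (mult_gap lam j) (x (gap_right j) y)
  - mult_I lam * dotv (EI *m cI) (x (first_seg hN) y).

Definition segment_part (i : 'I_N) : param R n N -> R :=
  segment_cost A (init_weight i) (final_weight i) (flow_covector i) (x i) (t i).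

Lemma gap_left_neq_last (j : 'I_N.-1) : gap_left j != last_seg hN.
Proof. by rewrite -val_eqE /= ltn_eqF // ltn_ord. Qed.

Lemma flow_covector_gap (j : 'I_N.-1) :
  flow_covector (gap_left j) = - mult_gap lam j.
Proof. by rewrite /flow_covector -[gap_left j : nat]/(val j) valK. Qed.

Lemma flow_covector_last :
  flow_covector (last_seg hN) = - (mult_U lam *: (EU *m cU)).
Proof. by rewrite /flow_covector insubF //= ltnn. Qed.

Lemma sum_segment_part (y : param R n N) :
  let z i := flow A (t i y) (x i y) in
  \sum_(i < N) segment_part i y =
  2^-1 * \sum_i t i y ^+ 2
  + 2^-1 * (mult_I lam * dotv (x (first_seg hN) y) (EI *m x (first_seg hN) y))
  + 2^-1 * (mult_U lam * dotv (z (last_seg hN)) (EU *m z (last_seg hN)))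
  - (\sum_(j < N.-1) dotv (mult_gap lam j) (z (gap_left j))
     + mult_U lam * dotv (EU *m cU) (z (last_seg hN))).
Proof.
move=> z; rewrite /segment_part /segment_cost !big_split /= -!mulr_sumr.
congr (_ + 2^-1 * _ + 2^-1 * _ + _).
(* [init_weight] vanishes away from the first segment, so a single summand remains; likewise below
   for [final_weight] and the last one. *)
- rewrite (bigD1 (first_seg hN)) //= big1 => [|i /negPf i1].
    by rewrite /init_weight eqxx addr0 -scalemxAl dotvZr.
  by rewrite /init_weight i1 mul0mx dotv0r.
- rewrite (bigD1 (last_seg hN)) //= big1 => [|i /negPf iN].
    by rewrite /final_weight eqxx addr0 -scalemxAl dotvZr.
  by rewrite /final_weight iN mul0mx dotv0r.
rewrite (sum_gap_last hN) flow_covector_last dotvNl dotvZl opprD -sumrN.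
by congr (_ + _); apply: eq_bigr => j _; rewrite flow_covector_gap dotvNl.
Qed.

(** Both ellipsoid squares are expanded about their centres. The linear term of the initial one is
    linear in [y] and goes to [affine_part]; that of the final one is linear only in z = e^{At}x and
    goes to the covector of the last segment. *)
Lemma lagrangian_split (y : param R n N) :
  lagrangian hN A EI EU cI cU y lam =
  affine_part y + \sum_(i < N) segment_part i y
  + (2^-1 * (mult_I lam * (dotv cI (EI *m cI) - 1))
     + 2^-1 * (mult_U lam * (dotv cU (EU *m cU) - 1))).
Proof.
rewrite /lagrangian /constraint mult_constraintE /objective sum_segment_part.
have sqE (E : 'M[R]_n) (u c : 'cV[R]_n) : E^T = E ->
    sqnorm E (u - c) = dotv u (E *m u) - 2 * dotv (E *m c) u + dotv c (E *m c).
  move=> symE; rewrite sqnormE mulmxBr !(dotvDl, dotvDr, dotvNl, dotvNr).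
  by rewrite (dotv_adj E c u) symE (dotvC u (E *m c)); ring.
rewrite !sqE // /affine_part /x /t.
under [X in _ + (_ + (X + _)) = _]eq_bigr do rewrite dotvDr dotvNr.
rewrite sumrB.
by field.
Qed.
End LagrangianSplit.

(** * Assembly of the segment Hessians and identification of their entries *)

Theorem theorem2 (R : realType) (n N : nat) (hN : (2 <= N)%N)
    (A EI EU : 'M[R]_n) (cI cU : 'cV[R]_n)
    (hEI : sym_posdef EI) (hEU : sym_posdef EU)
    (chi : param R n N) (ht : forall i : 'I_N, 0 <= seg_time chi i)
    (lam : multiplier R n N) :
  let L := fun y : param R n N => lagrangian hN A EI EU cI cU y lam in
  let x := seg_state chi in
  let t := seg_time chi in
  let e := fun i : 'I_N => expmx (t i *: A) in
  let lamI := mult_I lam in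
  let lamU := mult_U lam in
  let i1 := first_seg hN in
  let iN := last_seg hN in
  twice_differentiable L chi /\
  exists (Ab : 'I_N -> 'M[R]_n) (v : 'I_N -> 'cV[R]_n) (alpha : 'I_N -> R),
    hessian L chi =
      \mxdiag_(i < N) block_mx (Ab i) (v i) (v i)^T (alpha i)%:M
    /\ (forall j : 'I_N.-1, let i := gap_left j in
          v i = - ((A *m e i)^T *m mult_gap lam j))
    /\ (forall j : 'I_N.-1, let i := gap_left j in
          alpha i =
            - ((A ^+ 2 *m e i *m x i)^T *m mult_gap lam j) 0 0 + 1)
    /\ Ab i1 = lamI *: EI
    /\ (forall i : 'I_N, i != i1 -> i != iN -> Ab i = 0)
    /\ Ab iN = lamU *: (expmx (t iN *: A^T) *m EU *m e iN)
    /\ v iN = lamU *: ((A *m e iN)^T *m EU *m (e iN *m x iN - cU))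
              + lamU *: (expmx (t iN *: A^T) *m EU *m A *m e iN *m x iN)
    /\ alpha iN =
         lamU * ((A ^+ 2 *m e iN *m x iN)^T *m EU *m (e iN *m x iN - cU)) 0 0
         + lamU * ((A *m e iN *m x iN)^T *m EU *m (A *m e iN *m x iN)) 0 0
         + 1.
Proof.
move=> L x t e lamI lamU i1 iN.
have [[symEI _] [symEU _]] := (hEI, hEU).
(* N >= 2 keeps the initial and final weights on different blocks. *)
have i1N : i1 != iN by rewrite -val_eqE /= neq_ltn -subn1 subn_gt0 hN.
pose P := init_weight hN EI lam; pose Q := final_weight hN EU lam.
pose d := flow_covector EU cU lam.
pose X i (y : param R n N) := seg_state y i.
pose T i (y : param R n N) := seg_time y i.
have dX i y : is_diff y (X i) (X i) by exact: is_diff_seg_state.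
have dT i y : is_diff y (T i) (T i) by exact: is_diff_seg_time.
have symP i : (P i)^T = P i.
  by rewrite /P /init_weight; case: ifP; rewrite ?trmx0 // linearZ /= symEI.
have symQ i : (Q i)^T = Q i.
  by rewrite /Q /final_weight; case: ifP; rewrite ?trmx0 // linearZ /= symEU.
have Q0 j : Q (gap_left j) = 0.
  by rewrite /Q /final_weight (negPf (gap_left_neq_last _ _)).
have QN : Q iN = lamU *: EU by rewrite /Q /final_weight eqxx.
have [tdL hessL] : twice_differentiable L chi /\ hessian L chi =
    \mxdiag_(i < N) segment_hess A (P i) (Q i) (d i) (X i) (T i) chi.
  pose l := affine_part hN EI cI lam.
  have dl y : is_diff y l l.
    apply: is_diffB.
      apply: is_diff_sum => j; have dXj := dX (gap_right j) y.
      apply: is_diff_eq; first exact: is_diff_dotv (is_diff_cst _ y) dXj.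
      by apply/funext => h; rewrite dotv0l add0r.
    have dX1 := is_diff_dotv (is_diff_cst (EI *m cI) y) (dX i1 y).
    have dZX1 := is_diffZ (mult_I lam) dX1.
    apply: (is_diff_eq dZX1); apply/funext => h; congr (_ * _).
    by rewrite dotv0l add0r.
  apply: (@hessian_of_diff _ _ _ (fun y h => l h +
    \sum_i segment_cost_diff A (P i) (Q i) (d i) (X i) (T i) y h)) => [y|u].
    pose S z := \sum_i segment_part hN A EI EU cU lam i z.
    (* [c] is the last summand of [lagrangian_split], which does not depend on the parameters. *)
    have [c ->] : exists c, L = l + S + cst c.
      by eexists; apply/funext => z; exact: lagrangian_split.
    have dS : is_diff y S (fun h => \sum_i
          segment_cost_diff A (P i) (Q i) (d i) (X i) (T i) y h).
      by apply: is_diff_sum => i; exact: is_diff_segment_cost.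
    have dlSc := is_diffD (is_diffD (dl y) dS) (is_diff_cst c y).
    by apply: (is_diff_eq dlSc); rewrite addr0.
  (* For fixed [u] the term [l u] is constant, so the affine part drops out of the second
     differential. *)
  have dS := is_diff_sum (index_enum 'I_N) (fun i => is_diff_segment_cost_diff
    A (P i) (d i) (dX i) (dT i) (symQ i) chi u).
  apply: (is_diff_eq (is_diffD (is_diff_cst (l u) chi) dS)).
  apply/funext => w; rewrite dotv_mxdiag -[LHS]/(0 + _) add0r.
  by apply: eq_bigr => i _; rewrite !segment_varE.
split=> //.
exists (fun i => segment_hess_xx A (P i) (Q i) (T i) chi).
exists (fun i => segment_hess_xt A (Q i) (d i) (X i) (T i) chi).
exists (fun i => segment_hess_tt A (Q i) (d i) (X i) (T i) chi).
rewrite /segment_hess_xx /segment_hess_xt /segment_hess_tt.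
split; first exact: hessL.
split.
  (* Off the last segment Q = 0 and d is minus the gap multiplier, so only the terms linear in d
     survive. *)
  move=> j; rewrite Q0 /d flow_covector_gap mulmx0 !mul0mx add0r addr0.
  by rewrite mulmxN.
split.
  move=> j; rewrite Q0 /d flow_covector_gap !mul0mx add0r dotv0r addr0 dotvNr.
  by rewrite mulmxA.
split.
  rewrite /Q /final_weight (negPf i1N) mulmx0 mul0mx addr0.
  by rewrite /P /init_weight eqxx.
split.
  move=> i i1' iN'; rewrite /Q /final_weight (negPf iN') mulmx0 mul0mx addr0.
  by rewrite /P /init_weight (negPf i1').
have trE : (e iN)^T = expmx (t iN *: A^T) by rewrite /e tr_expmx linearZ.
(* On the last segment Qz and d recombine into the gradient in z of the weighted final
   constraint. *)
have gN : lamU *: EU *m (e iN *m x iN) + d iN =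
    lamU *: (EU *m (e iN *m x iN - cU)).
  by rewrite /d flow_covector_last -scalemxAl -scalerBr mulmxBr.
rewrite QN -/(x iN) -/(t iN) -/(e iN) trE gN.
split.
  rewrite /P /init_weight eq_sym (negPf i1N) add0r.
  by rewrite -scalemxAr -scalemxAl.
split.
  by rewrite -!scalemxAr -!scalemxAl -!mulmxA.
rewrite dotvZr -!scalemxAl dotvZr /dotv.
by rewrite !mulmxA.
Qed.
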